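(* Let $n\in\mathbb{N}$, let $x_c\in\mathbb{R}$ be fixed and known, and let $\tilde F,\tilde B>0$. Let $\mathbf{I}=(I_1,\dots,I_n)$ have independent components with $I_i\sim \mathrm{Poisson}(\lambda_i(x_c,\tilde F))$, where $\lambda_i(x_c,\tilde F)=\tilde F\, g_i(x_c)+\tilde B$, so that the likelihood is $$L(\mathbf{I};x_c,\tilde F,\tilde B)=\prod_{i=1}^n \frac{e^{-\lambda_i(x_c,\tilde F)}\,\lambda_i(x_c,\tilde F)^{I_i}}{I_i!}.$$ Then the Fisher information matrix for the parameter vector $\boldsymbol\theta=(\tilde F,\tilde B)$ is $$\mathcal{I}_{\boldsymbol\theta}=\begin{bmatrix}\displaystyle\sum_{i=1}^n\frac{g_i^2(x_c)}{\lambda_i(x_c,\tilde F)} & \displaystyle\sum_{i=1}^n\frac{g_i(x_c)}{\lambda_i(x_c,\tilde F)}\\[2mm] \displaystyle\sum_{i=1}^n\frac{g_i(x_c)}{\lambda_i(x_c,\tilde F)} & \displaystyle\sum_{i=1}^n\frac{1}{\lambda_i(x_c,\tilde F)}\end{bmatrix}.$$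
   Context: Pixel model: $\phi(\cdot,\sigma)$ is a probability density on $\mathbb{R}$ (the point spread function, with width parameter $\sigma>0$), $\Delta x>0$ is the pixel size, $x_1,\dots,x_n$ are the pixel centers with $x_{i+1}-x_i=\Delta x$, and $g_i(x_c)=\int_{x_i-\Delta x/2}^{x_i+\Delta x/2}\phi(x-x_c,\sigma)\,dx\ge 0$. $\tilde F$ is the source flux and $\tilde B$ the (homogeneous) background per pixel. The Fisher information matrix of a parameter vector $\boldsymbol\theta=(\theta_1,\dots,\theta_m)$ is the $m\times m$ matrix with entries $[\mathcal{I}_{\boldsymbol\theta}]_{(k,l)}=-\mathbb{E}_{\mathbf{I}\sim L(\cdot;\boldsymbol\theta)}\left\{\frac{\partial^2\ln L(\mathbf{I};\boldsymbol\theta)}{\partial\theta_k\,\partial\theta_l}\right\}$. Here $\theta_1=\tilde F$ and $\theta_2=\tilde B$. *)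

(* Defs.v *)
From HB Require Import structures.
From mathcomp Require Import all_boot all_order all_algebra.
From mathcomp Require Import all_classical all_reals all_analysis.

Set Implicit Arguments.
Unset Strict Implicit.
Unset Printing Implicit Defensive.

Import Order.TTheory GRing.Theory Num.Theory.
Import numFieldNormedType.Exports.

Local Open Scope classical_set_scope.
Local Open Scope ring_scope.

Definition probability_density (R : realType) (f : R -> R) : Prop :=
  [/\ measurable_fun setT f, forall y, 0 <= f y
    & (\int[@lebesgue_measure R]_y (f y)%:E = 1)%E].

Section pixel_model.
Context (R : realType) (n : nat).
Variables (phi : R -> R -> R) (sigma dx : R) (x : 'I_n -> R) (xc : R).

Definition pixel_response (i : 'I_n) : R :=
  Rintegral (@lebesgue_measure R) `[x i - dx / 2, x i + dx / 2]
    (fun y => phi (y - xc) sigma).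

Definition intensity (F B : R) (i : 'I_n) : R := F * pixel_response i + B.

(* The parameter vector is theta = (F, B): F = theta 0 0, B = theta 0 1. *)
Definition poisson_likelihood (o : 'I_n -> nat) (theta : 'rV[R]_2) : R :=
  \prod_(i < n)
    (expR (- intensity (theta 0 0) (theta 0 1) i)
      * intensity (theta 0 0) (theta 0 1) i ^+ o i / (o i)`!%:R).

End pixel_model.

Section random_variables.
Context d (Omega : measurableType d) (R : realType) (P : probability Omega R).

Definition mutually_independent d' (T : measurableType d') (n : nat)
    (X : 'I_n -> {RV P >-> T}) : Prop :=
  forall (J : {set 'I_n}) (A : 'I_n -> set T),
    (forall i, measurable (A i)) ->
    (P [set w | forall i, i \in J -> A i (X i w)]
      = \prod_(i in J) P (X i @^-1` A i))%E.

(* The second argument of [poisson_prob] is a dummy. *)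
Definition poisson_distributed (X : {RV P >-> nat}) (rate : R) : Prop :=
  forall U : set nat, distribution P X U = poisson_prob rate 0%N U.

End random_variables.

Section fisher_information.
Context (R : realType) (m : nat).

Definition partial (k : 'I_m) (f : 'rV[R]_m -> R) : 'rV[R]_m -> R :=
  fun theta => 'D_(delta_mx 0 k) f theta.

Definition has_partial (k : 'I_m) (f : 'rV[R]_m -> R) (theta : 'rV[R]_m) :
    Prop :=
  derivable f theta (delta_mx 0 k).

Context d (Omega : measurableType d) (P : probability Omega R) (n : nat).
Variables (X : 'I_n -> {RV P >-> nat}) (L : ('I_n -> nat) -> 'rV[R]_m -> R).
Variable theta : 'rV[R]_m.

Definition log_likelihood (o : 'I_n -> nat) : 'rV[R]_m -> R :=
  fun t => ln (L o t).

Definition log_likelihood_hessian (k l : 'I_m) (w : Omega) : R :=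
  partial k (partial l (log_likelihood (fun i => X i w))) theta.

(* X ~ L(.; theta) *)
Definition has_likelihood : Prop :=
  forall o : 'I_n -> nat,
    P [set w | forall i, X i w = o i] = (L o theta)%:E.

(* [derive] and the integral are total functions; this says that the
   derivatives and expectations in [fisher_information] really exist. *)
Definition fisher_information_exists : Prop :=
  (forall (o : 'I_n -> nat) (k l : 'I_m),
     (\forall t \near theta, has_partial l (log_likelihood o) t) /\
     has_partial k (partial l (log_likelihood o)) theta) /\
  (forall k l : 'I_m,
     P.-integrable setT (EFin \o log_likelihood_hessian k l)).

Definition fisher_information : 'M[\bar R]_m :=
  \matrix_(k, l) (- 'E_P[log_likelihood_hessian k l])%E.

End fisher_information.

Definition mx22 (T : Type) (a b c e : T) : 'M[T]_2 :=
  \matrix_(k, l) if k == 0 then (if l == 0 then a else b)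
                 else (if l == 0 then c else e).

(* Main.v *)
(** Each rate [lambda_i] is affine in [theta = (F, B)], with slope [g_i] along
    [F] and [1] along [B].  Where the rates are positive the log-likelihood is
    [sum_i (- lambda_i + o_i ln lambda_i - ln o_i!)], so its second partial
    derivatives are [- sum_i slope_k slope_l o_i / lambda_i^2], linear in the
    counts; the Poisson mean [E(I_i) = lambda_i] then gives the matrix. *)

Require Import Defs.
From HB Require Import structures.
From mathcomp Require Import all_boot all_order all_algebra.
From mathcomp Require Import ring.
From mathcomp Require Import all_classical all_reals all_analysis.
From mathcomp Require Import measurable_realfun.

Set Implicit Arguments.
Unset Strict Implicit.
Unset Printing Implicit Defensive.

Import Order.TTheory GRing.Theory Num.Theory.
Import numFieldNormedType.Exports.

Local Open Scope classical_set_scope.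
Local Open Scope ring_scope.

(** * Directional derivatives as derivatives along a line *)

(** Both sides have the same difference quotients. Partial derivatives thereby become accessible to
    the one-variable rules. *)
Lemma is_derive_line (R : realType) (V : normedModType R) (f : V -> R)
    (x v : V) (df : R) :
  is_derive x v f df <-> is_derive (0 : R) 1 (fun h => f (h *: v + x)) df.
Proof.
have E : 'D_v f x = 'D_1 (fun h : R => f (h *: v + x)) 0.
  rewrite /derive; set g1 := fun h => h^-1 *: _.
  set g2 := fun h => h^-1 *: _; suff -> : g1 = g2 by [].
  apply/funext => h; rewrite /g1 /g2 /=.
  by rewrite addr0 scale0r add0r [_%:A]mulr1.
split=> -[fd fE].
  by apply: DeriveDef; [exact: (derivable1P _ _ _).1 fd|rewrite -E].
by apply: DeriveDef; [exact: (derivable1P _ _ _).2 fd|rewrite E].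
Qed.

(** Restricting to the line through [x] along [v] reduces this to the one-variable chain rule, so
    [f] need only be derivable along [v]. *)
Lemma is_derive_comp_scalar (R : realType) (V : normedModType R) (f : V -> R)
    (phi : R -> R) (x v : V) (df dphi : R) :
  is_derive x v f df -> is_derive (f x) 1 phi dphi ->
  is_derive x v (phi \o f) (df * dphi).
Proof.
move=> /is_derive_line f1 phi1; apply/is_derive_line; rewrite mulrC.
apply: (@is_derive1_comp _ phi (fun h => f (h *: v + x))).
by rewrite scale0r add0r.
Qed.

(** * First and second partial derivatives of the log-likelihood *)

Section log_likelihood_derivatives.
Context (R : realType) (n : nat) (phi : R -> R -> R) (sigma dx : R)
  (x : 'I_n -> R) (xc : R).

Let rate (t : 'rV[R]_2) (i : 'I_n) : R :=
  intensity phi sigma dx x xc (t 0 0) (t 0 1) i.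

Let slope (k : 'I_2) (i : 'I_n) : R :=
  if k == 0 then pixel_response phi sigma dx x xc i else 1.

Lemma pixel_response_ge0 i : (forall y, 0 <= phi y sigma) ->
  0 <= pixel_response phi sigma dx x xc i.
Proof.
by move=> phi0; apply: Rintegral_ge0 => y _; exact: phi0.
Qed.

Lemma is_derive_intensity (t : 'rV[R]_2) k i :
  is_derive t (delta_mx 0 k) (rate ^~ i) (slope k i).
Proof.
apply/is_derive_line.
have -> : (fun h : R => rate (h *: delta_mx 0 k + t) i) =
    cst (rate t i) + slope k i \*: id.
  apply/funext => h; rewrite /rate /slope /intensity !fctE !mxE /=.
  have : k = 0 \/ k = 1.
    by case: k => -[|[|//]] ?; [left|right]; exact: val_inj.
  by case=> ->; rewrite /= /GRing.scale /=; ring.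
apply: is_derive_eq.
by rewrite add0r [_ *: _]mulr1.
Qed.

(** Each rate is continuous and there are finitely many pixels. Differentiating needs the closed
    form of the log-likelihood on a whole neighbourhood, not only at [t]. *)
Lemma near_intensity_gt0 (t : 'rV[R]_2) : (forall i, 0 < rate t i) ->
  \forall s \near t, forall i, 0 < rate s i.
Proof.
move=> t0.
apply: (@filter_forall _ _ (fun i s => 0 < rate s i) (nbhs t) _) => i.
apply: (cvgr_gt (rate t i)); last exact: t0.
rewrite /rate /intensity; apply: cvgD; last exact: coord_continuous.
by apply: cvgM; [exact: coord_continuous|exact: cvg_cst].
Qed.

Lemma log_poisson_likelihood (o : 'I_n -> nat) (t : 'rV[R]_2) :
  (forall i, 0 < rate t i) ->
  log_likelihood (poisson_likelihood phi sigma dx x xc) o t =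
  \sum_(i < n) (- rate t i + (o i)%:R * ln (rate t i) - ln (o i)`!%:R).
Proof.
move=> t0; rewrite /log_likelihood /poisson_likelihood -/(rate t _).
have p0 i : 0 < expR (- rate t i) * rate t i ^+ o i / (o i)`!%:R.
  by rewrite divr_gt0 ?mulr_gt0 ?expR_gt0 ?exprn_gt0 ?ltr0n ?fact_gt0.
pose p i := expR (- rate t i) * rate t i ^+ o i / (o i)`!%:R.
(* Positivity of the partial product is carried through the induction, since [lnM] needs both
   factors positive. *)
have [_ ->] : 0 < \prod_(i < n) p i /\
    ln (\prod_(i < n) p i) = \sum_(i < n) ln (p i).
  apply: (big_rec2 (fun q s => 0 < q /\ ln q = s)); first by rewrite ln1.
  move=> i s q _ [q0 <-]; rewrite mulr_gt0 ?p0//; split=> //.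
  by rewrite lnM ?posrE ?p0.
apply: eq_bigr => i _.
rewrite ln_div ?posrE ?mulr_gt0 ?expR_gt0 ?exprn_gt0 ?ltr0n ?fact_gt0//.
by rewrite lnM ?posrE ?expR_gt0 ?exprn_gt0// expRK lnXn// mulr_natl.
Qed.

Lemma is_derive_log_likelihood (o : 'I_n -> nat) (t : 'rV[R]_2) l :
  (forall i, 0 < rate t i) ->
  is_derive t (delta_mx 0 l)
    (log_likelihood (poisson_likelihood phi sigma dx x xc) o)
    (\sum_(i < n) slope l i * ((o i)%:R / rate t i - 1)).
Proof.
move=> t0.
apply: (@near_eq_is_derive _ _ _ (\sum_(i < n)
  ((fun r => - r + (o i)%:R * ln r - ln (o i)`!%:R) \o rate ^~ i))).
  have := near_intensity_gt0 t0; apply: filterS => s s0.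
  by rewrite log_poisson_likelihood// fct_sumE.
apply: is_derive_sum => i; apply: is_derive_comp_scalar.
  exact: is_derive_intensity.
have ? := is_derive1_ln (t0 i).
have -> : (fun r : R => - r + (o i)%:R * ln r - ln (o i)`!%:R) =
  - id + (o i)%:R \*: (@ln R : R -> R) - cst (ln (o i)`!%:R) by [].
apply: is_derive_eq.
by rewrite subr0 addrC.
Qed.

Lemma is_derive2_log_likelihood (o : 'I_n -> nat) (t : 'rV[R]_2) k l :
  (forall i, 0 < rate t i) ->
  is_derive t (delta_mx 0 k)
    (partial l (log_likelihood (poisson_likelihood phi sigma dx x xc) o))
    (\sum_(i < n) - (slope k i * slope l i / rate t i ^+ 2) * (o i)%:R).
Proof.
move=> t0.
(* The first partial derivative has its closed form at every point near [t], so that form may be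
   differentiated in its place. *)
apply: (@near_eq_is_derive _ _ _ (\sum_(i < n)
  ((fun r => slope l i * ((o i)%:R / r - 1)) \o rate ^~ i))).
  have := near_intensity_gt0 t0; apply: filterS => s s0.
  have [_] := is_derive_log_likelihood o l s0.
  by rewrite /partial => ->; rewrite fct_sumE.
apply: is_derive_sum => i.
(* The summand is put in the shape given by the chain rule: the slope of the rate times the
   derivative of the outer function of [r]. *)
have -> : - (slope k i * slope l i / rate t i ^+ 2) * (o i)%:R =
    slope k i * (slope l i *: ((o i)%:R *: (- rate t i ^- 2 *: 1) - 0)).
  rewrite subr0 /GRing.scale /= mulr1 !mulrN !mulNr; congr (- _).
  by rewrite -!mulrA [(o i)%:R * _]mulrC.
apply: is_derive_comp_scalar; first exact: is_derive_intensity.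
have r0 : rate t i != 0 by rewrite gt_eqF.
have -> : (fun r : R => slope l i * ((o i)%:R / r - 1)) =
  slope l i \*: ((o i)%:R \*: (fun r : R => r^-1) - cst 1) by [].
have ? : is_derive (rate t i) 1 (fun r : R => r^-1) (- rate t i ^- 2 *: 1).
  exact: (@is_deriveV _ id).
by apply: is_derive_eq.
Qed.

End log_likelihood_derivatives.

(** * Mean and integrability of a Poisson variable *)

Lemma ge0_integral_nat (R : realType) (mu : {measure set nat -> \bar R})
    (f : nat -> \bar R) : (forall k, 0 <= f k)%E ->
  (\int[mu]_k f k = \sum_(k <oo) f k * mu [set k])%E.
Proof.
move=> f0.
have <- : \bigcup_k [set k] = [set: nat].
  by apply/seteqP; split=> // k _; exists k.
rewrite ge0_integral_bigcup//; last by move=> i j _ _ [k [-> ->]].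
apply: eq_eseriesr => k _.
rewrite (eq_integral (cst (f k))); last by move=> j /[!inE] /= ->.
by rewrite integral_cst.
Qed.

(** The term at 0 vanishes, and [k.+1] times the mass at [k.+1] is [rate] times the mass at [k];
    what remains is [rate] times the total mass 1. *)
Lemma poisson_mean (R : realType) (rate : R) : 0 < rate ->
  (\sum_(k <oo) k%:R%:E * (poisson_pmf rate k)%:E = rate%:E)%E.
Proof.
move=> rate0.
have pmf0 k : (0 <= (poisson_pmf rate k)%:E)%E.
  by rewrite lee_fin poisson_pmf_ge0.
have term0 k : (0 <= k%:R%:E * (poisson_pmf rate k)%:E)%E.
  by rewrite mule_ge0// lee_fin.
rewrite nneseries_recl// mul0e add0e -nneseries_addn//.
rewrite (eq_eseriesr (g := fun k => rate%:E * (poisson_pmf rate k)%:E)%E).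
  rewrite nneseriesZl// nneseries_esumT//.
  have := probability_setT (poisson_prob rate 0).
  by rewrite /= {1}/poisson_prob rate0 => ->; rewrite mule1.
move=> k _; rewrite addn1 /poisson_pmf rate0 -!EFinM factS natrM invfM exprS.
congr EFin; have ? : (k.+1%:R : R) != 0 by rewrite pnatr_eq0.
have ? : (k`!%:R : R) != 0 by rewrite pnatr_eq0 -lt0n fact_gt0.
field.
by apply/andP.
Qed.

Section poisson_random_variable.
Context d (Omega : measurableType d) (R : realType) (P : probability Omega R).

Lemma poisson_distributed_pmf (X : {RV P >-> nat}) (rate : R) k : 0 < rate ->
  poisson_distributed X rate ->
  P (X @^-1` [set k]) = (poisson_pmf rate k)%:E.
Proof.
move=> rate0 /(_ [set k]); rewrite /distribution /pushforward => ->.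
by rewrite /poisson_prob rate0 esum_set1// lee_fin poisson_pmf_ge0.
Qed.

(** A change of variables moves the integral to the law of [X] on [nat], where it is the series of
    [poisson_mean]. *)
Lemma poisson_distributed_integral (X : {RV P >-> nat}) (rate : R) : 0 < rate ->
  poisson_distributed X rate -> (\int[P]_w (X w)%:R%:E = rate%:E)%E.
Proof.
move=> rate0 Xrate.
rewrite -(@ge0_integral_distribution _ _ _ _ _ P X (fun k => k%:R%:E))//.
rewrite ge0_integral_nat//.
rewrite -[RHS](poisson_mean rate0); apply: eq_eseriesr => k _.
by rewrite -(poisson_distributed_pmf k rate0 Xrate).
Qed.

Lemma poisson_distributed_integrable (X : {RV P >-> nat}) (rate : R) :
  0 < rate -> poisson_distributed X rate ->
  P.-integrable setT (fun w => (X w)%:R%:E).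
Proof.
move=> rate0 Xrate; apply/integrableP; split.
  have natr_meas : @measurable_fun _ _ nat R setT (GRing.natmul 1) by [].
  exact/measurable_EFinP/(measurableT_comp natr_meas)/(measurable_funPT X).
under eq_integral do rewrite gee0_abs ?lee_fin//.
by rewrite (poisson_distributed_integral rate0 Xrate) ltry.
Qed.

End poisson_random_variable.

Theorem lemma3p1 (R : realType) (d : measure_display)
    (Omega : measurableType d) (P : probability Omega R) (n : nat)
    (phi : R -> R -> R) (sigma dx : R) (x : 'I_n -> R) (xc F B : R)
    (I : 'I_n -> {RV P >-> nat})
    (g := pixel_response phi sigma dx x xc)
    (lambda := intensity phi sigma dx x xc F B)
    (L := poisson_likelihood phi sigma dx x xc)
    (theta := \row_(k < 2) (if k == 0 then F else B) : 'rV[R]_2) :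
  0 < sigma -> probability_density (phi ^~ sigma) ->
  0 < dx -> (forall i j : 'I_n, j = i.+1 :> nat -> x j - x i = dx) ->
  0 < F -> 0 < B ->
  mutually_independent I ->
  (forall i, poisson_distributed (I i) (lambda i)) ->
  [/\ has_likelihood I L theta,
      fisher_information_exists I L theta
    & fisher_information I L theta =
      map_mx EFin
        (mx22 (\sum_(i < n) g i ^+ 2 / lambda i) (\sum_(i < n) g i / lambda i)
              (\sum_(i < n) g i / lambda i)      (\sum_(i < n) (lambda i)^-1))].
Proof.
move=> _ [_ phi0 _] _ _ F0 B0 indep poiss.
have rateE i : intensity phi sigma dx x xc (theta 0 0) (theta 0 1) i = lambda i.
  by rewrite !mxE.
(* Strictness comes from the background [B]; the source term [F * g i] is only nonnegative. *)
have lambda0 i : 0 < lambda i.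
  by rewrite ltr_wpDl// mulr_ge0 ?(ltW F0)// pixel_response_ge0.
have rate0 i : 0 < intensity phi sigma dx x xc (theta 0 0) (theta 0 1) i.
  by rewrite rateE.
pose slope k i : R := if k == 0 :> 'I_2 then g i else 1.
have hessE k l : EFin \o log_likelihood_hessian I L theta k l =
    fun w => (\sum_(i < n) (- (slope k i * slope l i / lambda i ^+ 2))%:E
      * (I i w)%:R%:E)%E.
  apply/funext => w; rewrite /= /log_likelihood_hessian.
  have [_ hE] := is_derive2_log_likelihood (fun i => I i w) k l rate0.
  rewrite [partial k _ _]hE -sumEFin; apply: eq_bigr => i _.
  by rewrite rateE -EFinM.
have term_int k l i : P.-integrable setT
    (fun w => (- (slope k i * slope l i / lambda i ^+ 2))%:E * (I i w)%:R%:E)%E.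
  apply: integrableZl => //.
  exact: (poisson_distributed_integrable (lambda0 i) (poiss i)).
split.
- move=> o.
  (* Independence over all pixels, with singleton events, factors the joint probability into the
     Poisson masses. *)
  have := indep [set: 'I_n]%SET (fun i => [set o i]) (fun=> Logic.I).
  have -> : [set w | forall i, i \in [set: 'I_n]%SET -> [set o i] (I i w)] =
      [set w | forall i, I i w = o i].
    apply/seteqP; split=> w Iw i; first by apply: Iw; rewrite inE.
    by move=> _; exact: Iw.
  move=> ->.
  under eq_bigr do rewrite (poisson_distributed_pmf _ (lambda0 _) (poiss _)).
  rewrite prodEFin /L /poisson_likelihood; congr EFin.
  apply: eq_big => [i|i _]; first by rewrite inE.
  by rewrite rateE /poisson_pmf lambda0 [RHS]mulrAC [RHS]mulrC mulrA mulrAC.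
- split=> [cnt k l|k l].
    split; last by have [] := is_derive2_log_likelihood cnt k l rate0.
    have := near_intensity_gt0 rate0; apply: filterS => t t0.
    by have [] := is_derive_log_likelihood cnt l t0.
  by rewrite hessE; apply: integrable_sum.
- apply/matrixP => k l; rewrite !mxE unlock.
  have -> : (fun w => (log_likelihood_hessian I L theta k l w)%:E) =
    EFin \o log_likelihood_hessian I L theta k l by [].
  rewrite hessE integral_sum//.
  (* The expectation is taken termwise, each count being replaced by its mean [lambda i]. *)
  rewrite (eq_bigr (fun i => (- (slope k i * slope l i / lambda i ^+ 2)
      * lambda i)%:E)); last first.
    move=> i _; rewrite integralZl//.
      by rewrite (poisson_distributed_integral (lambda0 i) (poiss i)).
    exact: (poisson_distributed_integrable (lambda0 i) (poiss i)).
  rewrite sumEFin -EFinN -sumrN.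
  (* The mean cancels one of the two factors [lambda i] in the denominator, and the signs cancel. *)
  have sumE : \sum_(i < n) - (- (slope k i * slope l i / lambda i ^+ 2)
      * lambda i) = \sum_(i < n) slope k i * slope l i / lambda i.
    apply: eq_bigr => i _; have ? : lambda i != 0 by rewrite gt_eqF.
    by field.
  rewrite sumE; congr EFin; rewrite /slope.
  by case: ifP => _; case: ifP => _; apply: eq_bigr => i _;
    rewrite ?mulr1 ?mul1r ?expr2.
Qed.
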